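(* Let $M$ be a complete connected non-compact Riemannian manifold, $\alpha\in(0,1)$, $q>1$, and $\sigma$ a Radon measure on $M$. Assume that the fractional Laplacian $(-\Delta)^\alpha$ is transient, and suppose that its Green kernel $G^{(\alpha)}$ is quasi-metric. Fix $o\in M$ and $a>0$ and set $$m(x)=G^{(\alpha)}(x,o)\wedge a^{-1},\qquad x\in M.$$ Then the following are equivalent: (1) There exists a positive solution $u$ to the integral inequality $u(x)\ge\int_M G^{(\alpha)}(x,y)u^q(y)\,d\sigma(y)$. (2) There exists a lower semi-continuous function $u:M\to(0,+\infty)$ such that $u(x)\ge\int_M G^{(\alpha)}(x,y)u^q(y)\,d\sigma(y)$ holds for all $x\in M$. (3) There is a constant $c>0$ such that for $\sigma$-a.e. $x\in M$, $m(x)\ge c\int_M G^{(\alpha)}(x,y)m^q(y)\,d\sigma(y)$. (4) There is a constant $c>0$ such that for all $x\in M$, $m(x)\ge c\int_M G^{(\alpha)}(x,y)m^q(y)\,d\sigma(y)$.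
   Context: $\mu$ is the Riemannian measure; $\Delta$ is the Laplace–Beltrami operator (the unique self-adjoint extension on $L^2(M,\mu)$ of $\Delta|_{C_c^\infty(M)}$), and $p_t(x,y)$, $t>0$, is the heat kernel, i.e. the smooth positive integral kernel (with respect to $\mu$) of $e^{t\Delta}$. The Green kernel of the fractional Laplacian $(-\Delta)^\alpha$ is $$G^{(\alpha)}(x,y)=\frac1{\Gamma(\alpha)}\int_0^\infty s^{\alpha-1}p_s(x,y)\,ds\in(0,+\infty],\qquad x,y\in M.$$ $(-\Delta)^\alpha$ is transient if there is a non-negative measurable function $f$ on $M$ with $\mu(\{f>0\})>0$ and $\int_M G^{(\alpha)}(x,y)f(y)\,d\mu(y)<+\infty$ for $\mu$-a.e. $x\in M$. $G^{(\alpha)}$ is quasi-metric if there is a constant $\kappa\ge1$ such that $G^{(\alpha)}(x,y)\wedge G^{(\alpha)}(y,z)\le\kappa G^{(\alpha)}(x,z)$ for all $x,y,z\in M$. A Radon measure is a locally finite Borel measure. Positive solution: let $u$ be a $\sigma$-a.e. defined function that admits a lower semi-continuous $\sigma$-version (an everywhere defined lower semi-continuous function equal to $u$ $\sigma$-a.e.); $u$ is called a positive solution to the integral inequality if for $\sigma$-a.e. $x\in M$ one has $u(x)\in(0,+\infty)$ and the integral inequality holds at $x$. $\wedge$ denotes minimum. *)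

(* Defs.v *)
From HB Require Import structures.
From mathcomp Require Import all_boot all_order all_algebra.
From mathcomp Require Import all_classical all_reals all_analysis.

Set Implicit Arguments.
Unset Strict Implicit.
Unset Printing Implicit Defensive.

Import Order.TTheory GRing.Theory Num.Theory.
Import numFieldNormedType.Exports.

Local Open Scope classical_set_scope.
Local Open Scope ring_scope.

Section euclidean.
Context {R : realType}.

(* f is of class C^k on U, where U is meant to be open *)
Fixpoint Ck_on m (k : nat) (U : set 'rV[R]_m) (f : 'rV[R]_m -> R) : Prop :=
  (forall v, U v -> {for v, continuous f}) /\
  match k with
  | 0 => True
  | k'.+1 => forall a : 'I_m,
      (forall v, U v -> derivable f v (delta_mx 0 a)) /\
      Ck_on k' U (fun v => 'D_(delta_mx 0 a) f v)
  end.

Definition smooth_on m (U : set 'rV[R]_m) (f : 'rV[R]_m -> R) : Prop :=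
  forall k, Ck_on k U f.

(* The m-dimensional Lebesgue integral, as an iterated integral; by Tonelli
   this is the integral against Lebesgue measure for Borel f >= 0. *)
Fixpoint lebesgue_int m : ('rV[R]_m -> \bar R) -> \bar R :=
  match m return ('rV[R]_m -> \bar R) -> \bar R with
  | 0 => fun f => f 0
  | m'.+1 => fun f =>
      (\int[@lebesgue_measure R]_t
        lebesgue_int (fun v : 'rV[R]_m' =>
          f (row_mx (const_mx t : 'rV[R]_1) v)))%E
  end.

Definition gamma_fun (s : R) : R :=
  \int[@lebesgue_measure R]_(t in `]0, +oo[) (t `^ (s - 1) * expR (- t)).

End euclidean.

(* A smooth n-manifold structure on the space M, given by an atlas, together
   with a Riemannian metric, given by its matrix in each chart. Vectors are
   rows, so the chain rule reads 'D_w f v = w *m 'J f v. *)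
Record riemannian (R : realType) (n : nat) (M : ptopologicalType) := Riemannian {
  chart_index : Type;
  dom : chart_index -> set M;
  chart : chart_index -> M -> 'rV[R]_n;
  chartV : chart_index -> 'rV[R]_n -> M;
  chart_at : M -> chart_index;
  metric : chart_index -> 'rV[R]_n -> 'M[R]_n;
  riem_hausdorff : hausdorff_space M;
  riem_second_countable : @second_countable M;
  dom_chart_at : forall x, dom (chart_at x) x;
  dom_open : forall i, open (dom i);
  chart_open : forall i, open (chart i @` dom i);
  chartK : forall i x, dom i x -> chartV i (chart i x) = x;
  chart_continuous : forall i x, dom i x -> {for x, continuous (chart i)};
  chartV_continuous : forall i v, (chart i @` dom i) v ->
    {for v, continuous (chartV i)};
  transition_smooth : forall i j (a : 'I_n),
    smooth_on (chart i @` (dom i `&` dom j))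
      (fun v => chart j (chartV i v) 0 a);
  metric_smooth : forall i (a b : 'I_n),
    smooth_on (chart i @` dom i) (fun v => metric i v a b);
  metric_sym : forall i v, (chart i @` dom i) v -> (metric i v)^T = metric i v;
  metric_posdef : forall i v (w : 'rV[R]_n), (chart i @` dom i) v -> w != 0 ->
    0 < (w *m metric i v *m w^T) 0 0;
  metric_transition : forall i j x, dom i x -> dom j x ->
    let J := 'J (chart j \o chartV i) (chart i x) in
    metric i (chart i x) = J *m metric j (chart j x) *m J^T
}.

Section geometry.
Context {R : realType} {n : nat} {M : ptopologicalType} (g : riemannian R n M).

Definition vol_density (i : chart_index g) (v : 'rV[R]_n) : R :=
  Num.sqrt (\det (metric i v)).

Definition smooth_fun (f : M -> R) : Prop :=
  forall i : chart_index g, smooth_on (chart i @` dom i) (f \o chartV i).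

Definition test_fun (f : M -> R) : Prop :=
  smooth_fun f /\ exists2 K : set M, compact K & forall x, ~ K x -> f x = 0.

(* In coordinates, with D := sqrt (det g),
   Laplacian f = D^-1 * \sum_a d_a (D * \sum_b g^{ab} * d_b f). *)
Definition laplacian (f : M -> R) (x : M) : R :=
  let i := chart_at g x in
  (vol_density i (chart i x))^-1 *
  \sum_(a < n) 'D_(delta_mx 0 a)
    (fun v => vol_density i v *
       \sum_(b < n) invmx (metric i v) a b *
                    'D_(delta_mx 0 b) (f \o chartV i) v) (chart i x).

Definition C1_curve (c : R -> M) : Prop :=
  continuous c /\
  forall (i : chart_index g) t, dom i (c t) ->
    derivable (chart i \o c) t 1 /\ {for t, continuous (derive1 (chart i \o c))}.

Definition speed (c : R -> M) (t : R) : R :=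
  let i := chart_at g (c t) in
  let w := derive1 (chart i \o c) t in
  Num.sqrt ((w *m metric i (chart i (c t)) *m w^T) 0 0).

Definition curve_length (c : R -> M) : \bar R :=
  (\int[@lebesgue_measure R]_(t in `[0%R, 1%R]) (speed c t)%:E)%E.

(* x and y are joined by a piecewise C^1 path of length l: a concatenation of
   C^1 curves, each parametrized by [0, 1] *)
Inductive piecewise_path : M -> M -> \bar R -> Prop :=
| PathNil x : piecewise_path x x 0%E
| PathCons c y l : C1_curve c -> piecewise_path (c 1) y l ->
    piecewise_path (c 0) y (curve_length c + l)%E.

Definition riem_dist (x y : M) : \bar R :=
  ereal_inf [set l | piecewise_path x y l].

Definition complete_riemannian : Prop :=
  forall u : nat -> M,
    (forall e : R, 0 < e -> exists N, forall j k, (N <= j)%N -> (N <= k)%N ->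
       (riem_dist (u j) (u k) < e%:E)%E) ->
    exists x, (fun k => riem_dist (u k) x) @ \oo --> 0%E.

End geometry.

Notation borel M := (g_sigma_algebraType (@open M)).

Section measures.
Context {R : realType} {n : nat} {M : ptopologicalType}.

Definition radon (sigma : {measure set (borel M) -> \bar R}) : Prop :=
  forall x : M, exists2 U, open_nbhs x U & (sigma U < +oo)%E.

Definition riemannian_measure (g : riemannian R n M)
    (mu : {measure set (borel M) -> \bar R}) : Prop :=
  forall (i : chart_index g) (A : set (borel M)),
    measurable A -> A `<=` dom i ->
    mu A = lebesgue_int (fun v =>
      (vol_density i v * \1_(chart i @` A) v)%:E).

End measures.

(* Unbounded operators on the real Hilbert space L^2(M, mu) are given by their
   graphs, as relations between square integrable functions. *)
Section L2.
Context {R : realType} {M : ptopologicalType}.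
Variable mu : {measure set (borel M) -> \bar R}.

Definition L2 (f : M -> R) : Prop := (f : borel M -> R) \in Lfun mu 2%:E.

Definition L2_norm (f : M -> R) : \bar R := Lnorm mu 2%:E (EFin \o f).

Definition L2_inner (f h : M -> R) : R := \int[mu]_x (f x * h x).

Definition self_adjoint (A : (M -> R) -> (M -> R) -> Prop) : Prop :=
  (forall f (e : R), L2 f -> 0 < e ->
     exists u v, A u v /\ (L2_norm (f \- u)%R < e%:E)%E) /\
  (forall f h, A f h <->
     [/\ L2 f, L2 h & forall u v, A u v -> L2_inner f v = L2_inner h u]).

(* P t = e^{tA} for t >= 0: the strongly continuous semigroup of bounded
   self-adjoint operators whose generator is the self-adjoint operator A *)
Definition generated_semigroup (A : (M -> R) -> (M -> R) -> Prop)
    (P : R -> (M -> R) -> (M -> R)) : Prop :=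
  [/\ (forall t, 0 <= t ->
        [/\ (forall f, L2 f -> L2 (P t f)),
            (forall k f h, L2 f -> L2 h ->
               {ae mu, forall x,
                 P t (fun y => k * f y + h y) x = k * P t f x + P t h x}),
            (exists C : R, forall f, L2 f ->
               (L2_norm (P t f) <= C%:E * L2_norm f)%E) &
            (forall f h, L2 f -> L2 h ->
               L2_inner (P t f) h = L2_inner f (P t h))]),
      (forall f, L2 f -> {ae mu, forall x, P 0 f x = f x}),
      (forall s t f, 0 <= s -> 0 <= t -> L2 f ->
         {ae mu, forall x, P (s + t) f x = P s (P t f) x}),
      (forall f, L2 f ->
         L2_norm (P t f \- f) @[t --> 0^'+] --> 0%E) &
      (forall f h, A f h <->
         [/\ L2 f, L2 h &
           L2_norm (fun x => t^-1 * (P t f x - f x) - h x)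
             @[t --> 0^'+] --> 0%E])].

End L2.

Section heat.
Context {R : realType} {n : nat} {M : ptopologicalType}.
Variables (g : riemannian R n M) (mu : {measure set (borel M) -> \bar R}).

Definition laplace_beltrami (A : (M -> R) -> (M -> R) -> Prop) : Prop :=
  self_adjoint mu A /\ (forall f, test_fun g f -> A f (laplacian g f)).

(* joint smoothness in (t, x, y), for t > 0 *)
Definition kernel_smooth (p : R -> M -> M -> R) : Prop :=
  forall i j : chart_index g,
    smooth_on
      [set w : 'rV[R]_(1 + (n + n)) |
        [/\ 0 < lsubmx w 0 0,
            (chart i @` dom i) (lsubmx (rsubmx w)) &
            (chart j @` dom j) (rsubmx (rsubmx w))]]
      (fun w => p (lsubmx w 0 0) (chartV i (lsubmx (rsubmx w)))
                                 (chartV j (rsubmx (rsubmx w)))).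

Definition heat_kernel (p : R -> M -> M -> R) : Prop :=
  [/\ kernel_smooth p,
      (forall t x y, 0 < t -> 0 < p t x y) &
      exists (A : (M -> R) -> (M -> R) -> Prop)
             (P : R -> (M -> R) -> (M -> R)),
        [/\ laplace_beltrami A,
            generated_semigroup mu A P &
            forall t f, 0 < t -> L2 mu f ->
              {ae mu, forall x,
                mu.-integrable setT (fun y : borel M => (p t x y * f y)%:E) /\
                P t f x = \int[mu]_y (p t x y * f y)}]].

End heat.

Section green.
Context {R : realType} {M : ptopologicalType}.
Local Open Scope ereal_scope.

Definition green (p : R -> M -> M -> R) (alpha : R) (x y : M) : \bar R :=
  ((gamma_fun alpha)^-1)%:E *
  \int[@lebesgue_measure R]_(s in `]0%R, +oo[)
    (s `^ (alpha - 1) * p s x y)%:E.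

(* transience of the operator whose Green kernel is G *)
Definition transient (mu : {measure set (borel M) -> \bar R})
    (G : M -> M -> \bar R) : Prop :=
  exists f : borel M -> R,
    [/\ measurable_fun setT f,
        (forall x, (0 <= f x)%R),
        0 < mu [set x | (0 < f x)%R] &
        {ae mu, forall x, \int[mu]_y (G x y * (f y)%:E) < +oo}].

Definition quasi_metric (G : M -> M -> \bar R) : Prop :=
  exists2 kappa : R, (1 <= kappa)%R &
    forall x y z, Order.min (G x y) (G y z) <= kappa%:E * G x z.

End green.

(* Main.v *)
Require Import Defs.
From HB Require Import structures.
From mathcomp Require Import all_boot all_order all_algebra.
From mathcomp Require Import all_classical all_reals all_analysis.
From mathcomp Require Import measurable_realfun ring lra.

Import Order.TTheory GRing.Theory Num.Theory.
Import numFieldNormedType.Exports.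
Local Open Scope classical_set_scope.
Local Open Scope ring_scope.

Set Implicit Arguments.
Unset Strict Implicit.
Unset Printing Implicit Defensive.

(** Write G for the Green kernel and d = 1/G. The hypothesis says that d is a
    quasi-metric, and m = 1 / max(d(., o), a). The equivalence is a statement
    about quasi-metric kernels; geometry only supplies that G is symmetric,
    positive and lower semi-continuous.

    Kernel part. The normalised kernel G(x,y) / (m(x) m(y)) is again
    quasi-metric ([ptolemy], an inequality of Ptolemy type). Fix x and order
    the points y by phi(y) = G(x,y) / m(y). If phi(z) <= phi(y) then G(x,z) is
    at most C (m(x)/m(y)) G(y,z) with C = kappa^2 ([kernel_le_of_sublevel]), so
    the part of a potential at x that comes from the sublevel set of y is
    controlled by the same potential at y ([sublevel_potential_le]).

    From this, if u >= G(u^q sigma), put V(y) for the integral of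
    G(x,.) u^q over {phi <= phi(y)}. Then u(y) >= m(y) V(y) / (C m(x)), while
    the integral of G(x,.) u^q over {V <= s} is at most s. So on the set where
    V / m(x) lies between 2^k and 2^(k+1) the integral of G(x,.) m^q is
    O(2^(k(1-q))) m(x), and these bounds sum to a geometric series because
    q > 1; on the set where V <= m(x) one uses u >= c m, which holds because a
    potential of a nonzero measure dominates m ([supersolution_ge_weight]).
    This is the passage from a solution to the bound G(m^q sigma) <= A m
    almost everywhere ([weight_potential_le_of_supersolution]). The same
    sublevel estimate is a maximum principle
    ([potential_maximum_principle]): such a bound on a set of full measure
    extends to every point with a larger constant. Once it holds everywhere, a
    suitable multiple of m is a solution, and m is lower semi-continuous since G
    is.

    Geometric part. The heat kernel is symmetric because e^(t Delta) is
    self-adjoint: two continuous kernels that give the same bilinear form on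
    indicator functions of small sets agree, provided every open set contains
    a set of positive finite Riemannian measure
    ([small_set_of_positive_measure]); in a chart this holds because the volume
    density is continuous and positive. Lower semi-continuity of G is Fatou's
    lemma. *)

(** * Integrals of nonnegative functions over sublevel sets *)

Section nonneg_integrals.
Context d (T : measurableType d) (R : realType).
Implicit Types (mu : {measure set T -> \bar R}) (D : set T) (f g h phi : T -> \bar R).
Local Open Scope ereal_scope.

Import HBNNSimple.

(** For a nonnegative function the integral is a supremum over the simple
    functions below it, hence monotone even on non-measurable functions. Both
    a solution that is merely almost everywhere equal to a measurable function
    and the partial integrals of an iterated integral call for this. *)
Lemma ge0_le_integral_nonmeas mu D f g :
  (forall x, D x -> 0 <= f x) -> (forall x, D x -> f x <= g x) ->
  \int[mu]_(x in D) f x <= \int[mu]_(x in D) g x.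
Proof.
move=> f0 fg; have g0 x : D x -> 0 <= g x.
  by move=> Dx; rewrite (le_trans (f0 _ Dx))// fg.
rewrite !ge0_integralE//; apply: ereal_sup_le => _ [h hf <-].
exists h => // x; apply: le_trans (hf x) _.
by rewrite !patchE; case: ifPn => // /set_mem; exact: fg.
Qed.

Lemma ereal_lt_seq (s : \bar R) : s != -oo ->
  exists u : (\bar R)^nat, [/\ {homo u : n m / (n <= m)%N >-> n <= m},
    forall n, u n < s & forall x, x < s -> exists n, x <= u n].
Proof.
case: s => [r _|_|//].
- exists (fun n => (r - n.+1%:R^-1)%:E); split.
  + move=> n m nm; rewrite lee_fin lerB// lef_pV2 ?posrE// ler_nat//.
  + by move=> n; rewrite lte_fin ltrBlDr ltrDl.
  + case=> [x|//|_]; last by exists 0%N; rewrite leNye.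
    rewrite lte_fin -subr_gt0 => /ltr_add_invr[k]; rewrite add0r => /ltW kr.
    by exists k; rewrite lee_fin lerBrDr addrC -lerBrDr.
- exists (fun n => n%:R%:E); split.
  + by move=> n m nm; rewrite lee_fin ler_nat.
  + by move=> n; rewrite ltry.
  + case=> [x _|//|_]; last by exists 0%N; rewrite leNye.
    exists (Num.truncn `|x|).+1; rewrite lee_fin (le_trans (ler_norm _))//.
    by rewrite ltW// truncnS_gt.
Qed.

(** The sublevel sets of [phi] at its values on [D] exhaust [D]: either [phi]
    attains its supremum on [D], or the levels approach the supremum and
    monotone convergence applies. This replaces the choice of a point of [D]
    that is extremal for [phi], which need not exist. *)
Lemma integral_le_sublevels mu D f phi (t : R) :
  measurable D -> measurable_fun setT phi -> measurable_fun setT f ->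
  (forall x, 0 <= f x) -> (0 <= t)%R ->
  (forall y, D y -> \int[mu]_(x in D `&` [set x | phi x <= phi y]) f x <= t%:E) ->
  \int[mu]_(x in D) f x <= t%:E.
Proof.
move=> mD mphi mf f0 t0 bound.
have msub s : measurable (D `&` [set x | phi x <= s]).
  by apply: emeasurable_fun_infty_c => //; exact: measurable_funTS.
pose s := ereal_sup (phi @` D).
have le_s x : D x -> phi x <= s by move=> Dx; apply: ereal_sup_ubound; exists x.
have [[y Dy ys]|nomax] := pselect (exists2 y, D y & phi y = s).
  suff -> : D = D `&` [set x | phi x <= phi y] by exact: bound.
  by apply/seteqP; split=> [x Dx|x []//]; split => //=; rewrite ys le_s.
have lt_s x : D x -> phi x < s.
  by move=> Dx; rewrite lt_neqAle le_s// andbT; apply/eqP => xs; apply: nomax; exists x.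
have [D0|/set0P[y0 Dy0]] := eqVneq D set0.
  by rewrite D0 integral_set0.
have sNy : s != -oo by rewrite -ltNye (le_lt_trans _ (lt_s _ Dy0))// leNye.
have [u [ndu us uex]] := ereal_lt_seq sNy.
pose F n := D `&` [set x | phi x <= u n].
have DF : D = \bigcup_n F n.
  apply/seteqP; split=> [x Dx|x [n _ []]//].
  by have [n xn] := uex _ (lt_s _ Dx); exists n.
have ndF : nondecreasing_seq F.
  move=> n m nm; rewrite subsetEset => x [Dx /= xn]; split => //=.
  by rewrite (le_trans xn)// ndu.
have cvgF := @ge0_nondecreasing_set_cvg_integral _ _ _ F f mu ndF
  (fun n => msub _) (fun n => measurable_funTS mf) (fun n x _ => f0 x).
rewrite DF -(cvg_lim _ cvgF)//; apply: lime_le; first by apply/cvg_ex; eexists; exact: cvgF.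
apply: nearW => n; have := us n => /ereal_sup_gt[_ [y Dy <-] uy].
apply: le_trans (bound y Dy); apply: (ge0_subset_integral _ (msub _) (msub _)) => //.
- by apply: measurable_funTS.
- by move=> x [Dx /= xu]; split => //=; rewrite (le_trans xu)// ltW.
Qed.

(** A down-closed set for [phi] is one of [phi <= s] and [phi < s], where [s]
    is the supremum of [phi] on it. *)
Lemma measurable_down_set D phi : measurable_fun setT phi ->
  (forall x y, D y -> phi x <= phi y -> D x) -> measurable D.
Proof.
move=> mphi down; pose s := ereal_sup (phi @` D).
have le_s x : D x -> phi x <= s by move=> Dx; apply: ereal_sup_ubound; exists x.
have [[y Dy ys]|nomax] := pselect (exists2 y, D y & phi y = s).
  suff -> : D = setT `&` [set x | phi x <= s] by exact: emeasurable_fun_infty_c.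
  apply/seteqP; split=> [x Dx|x [_ /=]]; first by split => //=; exact: le_s.
  by rewrite -ys; exact: down.
suff -> : D = setT `&` [set x | phi x < s] by exact: emeasurable_fun_infty_o.
apply/seteqP; split=> [x Dx|x [_ /=] /ereal_sup_gt[_ [y Dy <-] /ltW]].
  split => //=.
  by rewrite lt_neqAle le_s// andbT; apply/eqP => xs; apply: nomax; exists x.
exact: down.
Qed.
End nonneg_integrals.

(** * The Ptolemy inequality for a quasi-metric kernel *)

Section ptolemy.
Context (R : realType) (T : Type).
Local Open Scope ereal_scope.
Variables (G : T -> T -> \bar R) (m : T -> R) (kappa b : R) (o : T).
Hypotheses (G0 : forall x y, 0 <= G x y) (Gsym : forall x y, G x y = G y x).
Hypothesis k1 : (1 <= kappa)%R.
Hypothesis Gquasi : forall x y z, Order.min (G x y) (G y z) <= kappa%:E * G x z.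
Hypothesis mE : forall x, (m x)%:E = Order.min (G x o) b%:E.
Hypothesis m0 : forall x, (0 < m x)%R.

Let k0 : (0 < kappa)%R. Proof. exact: lt_le_trans k1. Qed.

Lemma min_weight_le_green x y :
  Order.min (m x)%:E (m y)%:E <= kappa%:E * G x y.
Proof.
apply: le_trans (Gquasi x o y); rewrite (Gsym o) !mE.
by rewrite le_min !ge_min !lexx !orbT.
Qed.

Lemma min_green_weight_le x y :
  Order.min (G x y) (m y)%:E <= (kappa * m x)%:E.
Proof.
rewrite EFinM.
have : (m x)%:E = G x o \/ (m x)%:E = b%:E.
  by rewrite mE minEle; case: ifP => _; [left|right].
case=> ->.
  apply: le_trans (Gquasi x y o); rewrite mE.
  by rewrite le_min !ge_min !lexx !orbT.
rewrite mE !ge_min -EFinM lee_fin ler_peMl ?orbT//.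
have := m0 x; rewrite -lte_fin mE lt_min => /andP[_].
by rewrite lte_fin => /ltW.
Qed.

(** In terms of d = 1/G and D = 1/m this reads
    d(x,z) D(y) <= kappa^2 max(d(x,y) D(z), d(y,z) D(x)). The quasi-triangle
    inequality bounds d(x,z), up to the factor kappa, by the larger of d(x,y),
    d(y,z), and also by the larger of D(x), D(z); likewise it bounds D(y) by
    max(d(x,y), D(x)) and by max(d(y,z), D(z)). The cases combine one bound on d(x,z) with one on
    D(y). *)
Lemma ptolemy x y z :
  Order.min (G x y * (m z)%:E) (G y z * (m x)%:E) <=
  (kappa ^+ 2)%:E * (G x z * (m y)%:E).
Proof.
have mul2 (a1 a2 : \bar R) (c1 c2 : \bar R) : 0 <= a1 -> 0 <= a2 ->
    a1 <= kappa%:E * c1 -> a2 <= kappa%:E * c2 ->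
    a1 * a2 <= (kappa ^+ 2)%:E * (c1 * c2).
  move=> a10 a20 h1 h2; rewrite expr2 EFinM muleACA.
  exact: lee_pmul.
have mm t : 0 <= (m t)%:E by rewrite lee_fin ltW.
have hxy := min_green_weight_le y x; rewrite (Gsym y) EFinM in hxy.
have hyz := min_green_weight_le y z; rewrite EFinM in hyz.
have hxz := Gquasi x y z.
have hm := min_weight_le_green x z.
rewrite ge_min; apply/orP.
have [gle|/ltW gle] := leP (G x y) (G y z).
- rewrite min_l// in hxz.
  move: hyz; rewrite ge_min => /orP[gy|zy]; last by left; exact: mul2.
  have gxy := le_trans gle gy.
  move: hm; rewrite ge_min => /orP[xz|zz].
  + by right; rewrite muleC; exact: mul2.
  + by left; rewrite muleC; exact: mul2.
- rewrite min_r// in hxz.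
  move: hxy; rewrite ge_min => /orP[gy|xy]; last by right; exact: mul2.
  have gyz := le_trans gle gy.
  move: hm; rewrite ge_min => /orP[xz|zz].
  + by right; rewrite muleC; exact: mul2.
  + by left; rewrite muleC; exact: mul2.
Qed.

End ptolemy.

(** * Potentials of kernels that satisfy the Ptolemy inequality *)

Section ptolemaic_potentials.
Context d (T : measurableType d) (R : realType).
Variables (sigma : {measure set T -> \bar R}) (G : T -> T -> \bar R).
Variables (m : T -> R) (C q : R).
Hypotheses (G0 : forall x y, (0 <= G x y)%E) (Gsym : forall x y, G x y = G y x).
Hypothesis mG : forall x, measurable_fun setT (G x).
Hypotheses (m0 : forall x, 0 < m x) (mm : measurable_fun setT m).
Hypothesis C0 : 0 < C.
Hypothesis Gptolemy : forall x y z,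
  (Order.min (G x y * (m z)%:E) (G y z * (m x)%:E) <=
   C%:E * (G x z * (m y)%:E))%E.

Local Open Scope ereal_scope.

(** The normalised kernel at [x], up to the factor 1/m(x): large values mean
    that [y] is close to [x] in the modified quasi-metric. *)
Let phi x y := G x y * ((m y)^-1)%:E.

Let mphi x : measurable_fun setT (phi x).
Proof.
apply: emeasurable_funM => //; apply/measurable_EFinP.
under eq_fun do rewrite -powR_inv1 ?ltW//.
exact: (measurableT_comp (measurable_powR _)).
Qed.

Let mGf x (f : T -> \bar R) : measurable_fun setT f ->
  measurable_fun setT (fun z => G x z * f z).
Proof. by move=> mf; exact: emeasurable_funM. Qed.

(** By the Ptolemy inequality for (y, x, z), the smaller of G(x,y) m(z) and
    G(x,z) m(y) is at most C G(y,z) m(x); the hypothesis says that the second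
    is the smaller one. *)
Lemma kernel_le_of_sublevel x y z : phi x z <= phi x y ->
  G x z <= (C * m x / m y)%:E * G y z.
Proof.
move=> zy.
have {}zy : G x z * (m y)%:E <= G x y * (m z)%:E.
  have := zy; rewrite /phi lee_pdivrMr// muleAC lee_pdivlMr//.
have := Gptolemy y x z; rewrite (Gsym y x) minC min_l// => h.
rewrite EFinM muleAC lee_pdivlMr// (le_trans h)//.
by rewrite (muleC (G y z)) muleA -EFinM.
Qed.

Lemma sublevel_potential_le D x y (f : T -> \bar R) : measurable D ->
  measurable_fun setT f -> (forall z, 0 <= f z) ->
  \int[sigma]_(z in D `&` [set z | phi x z <= phi x y]) (G x z * f z) <=
  (C * m x / m y)%:E * \int[sigma]_z (G y z * f z).
Proof.
move=> mD mf f0.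
have c0 : (0 <= C * m x / m y)%R by rewrite divr_ge0 ?mulr_ge0 ?ltW.
have mL : measurable (D `&` [set z | phi x z <= phi x y]).
  by apply: emeasurable_fun_infty_c => //; exact: measurable_funTS.
rewrite -ge0_integralZl_EFin//; [|by move=> z _; rewrite mule_ge0|exact: mGf].
apply: (@le_trans _ _ (\int[sigma]_(z in D `&` [set z | phi x z <= phi x y])
    ((C * m x / m y)%:E * (G y z * f z)))).
  apply: ge0_le_integral_nonmeas => z [_ /= zy]; first by rewrite mule_ge0.
  by rewrite muleA lee_wpmul2r// kernel_le_of_sublevel.
apply: ge0_subset_integral => //.
  by apply: emeasurable_funM => //; exact: mGf.
by move=> z _; rewrite !mule_ge0.
Qed.

(** Points of [E] see the potential at [x] through their sublevel sets, and
    these exhaust [E]. In metric terms the bound is transported to [x] from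
    points of [E] that are as close to [x] as possible. *)
Lemma potential_maximum_principle E (f : T -> \bar R) (A : R) :
  measurable E -> sigma (~` E) = 0 -> measurable_fun setT f ->
  (forall z, 0 <= f z) -> (0 <= A)%R ->
  (forall y, E y -> \int[sigma]_z (G y z * f z) <= (A * m y)%:E) ->
  forall x, \int[sigma]_z (G x z * f z) <= (C * A * m x)%:E.
Proof.
move=> mE sE mf f0 A0 bound x.
rewrite (ge0_negligible_integral (measurableC mE))//; last 2 first.
- exact: mGf.
- by move=> z _; rewrite mule_ge0.
rewrite setDE setCK setTI.
apply: (@integral_le_sublevels _ _ _ _ _ _ (phi x)) => //.
- exact: mGf.
- by move=> z; rewrite mule_ge0.
- by rewrite !mulr_ge0 // ltW.
move=> y Ey; apply: le_trans (sublevel_potential_le _ _ mE mf f0) _.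
have c0 : (0 <= C * m x / m y)%R by rewrite divr_ge0 ?mulr_ge0 ?ltW.
apply: le_trans (lee_wpmul2l _ (bound y Ey)) _; first by rewrite lee_fin.
by rewrite -EFinM lee_fin le_eqVlt; apply/orP/or_introl/eqP; field; rewrite gt_eqF.
Qed.

(** The contribution of the k-th dyadic level is a term of a geometric
    progression of ratio 2^(1-q). *)
Lemma level_gap (c : R) (k : nat) :
  ((C / 2 ^+ k) `^ q * (2 ^+ k.+1 * c) = 2 * C `^ q * (2 `^ (1 - q)) ^+ k * c)%R.
Proof.
have y0 : (0 < 2 `^ q :> R)%R by rewrite powR_gt0.
have -> : ((2 : R) `^ (1 - q) = 2 / 2 `^ q)%R.
  by rewrite powRD ?pnatr_eq0 ?implybT// powRr1// powRN.
have -> : ((C / 2 ^+ k) `^ q = C `^ q / (2 `^ q) ^+ k)%R.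
  rewrite powRM ?invr_ge0 ?exprn_ge0 ?ltW//; congr (_ * _)%R.
  rewrite -powR_inv1 ?exprn_ge0// powRAC powR_inv1 ?powR_ge0//.
  by rewrite -powR_mulrn// powRAC powR_mulrn// ltW.
rewrite exprMn exprVn exprS; field.
by rewrite expf_neq0// gt_eqF.
Qed.

(** Comparison with the blow-up of a differential inequality. For fixed [x]
    let V(y) be the integral of G(x,.) w^q over the points of [E] where
    phi <= phi(y). The hypothesis on [w] gives w >= m V / (C m(x)) on [E], so
    between V = 2^k m(x) and V = 2^(k+1) m(x) the integral of G(x,.) m^q grows
    by at most a fixed multiple of 2^(k(1-q)) m(x). Since V never exceeds w(x), which is finite, the
    levels exhaust [E], and the total does not depend on w(x). *)
Lemma weight_potential_le_of_supersolution E (w : T -> R) (c0 : R) :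
  (1 < q)%R -> measurable E -> sigma (~` E) = 0 ->
  measurable_fun setT w -> (forall x, 0 < w x)%R -> (0 < c0)%R ->
  (forall x, E x -> c0 * m x <= w x)%R ->
  (forall x, E x -> \int[sigma]_z (G x z * (w z `^ q)%:E) <= (w x)%:E) ->
  exists2 A : R, (0 <= A)%R &
    forall x, E x -> \int[sigma]_z (G x z * (m z `^ q)%:E) <= (A * m x)%:E.
Proof.
move=> q1 mE sE mw w0 c00 mw_le super.
have mfq (f : T -> R) : measurable_fun setT f ->
    measurable_fun setT (fun z => (f z `^ q)%:E).
  by move=> mf; apply/measurable_EFinP; exact: (measurableT_comp (measurable_powR q)).
have mGm x := mGf x (mfq _ mm); have mGw x := mGf x (mfq _ mw).
have Gm0 x z : 0 <= G x z * (m z `^ q)%:E by rewrite mule_ge0// lee_fin powR_ge0.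
have Gw0 x z : 0 <= G x z * (w z `^ q)%:E by rewrite mule_ge0// lee_fin powR_ge0.
pose r : R := (2 `^ (1 - q))%R.
have r0 : (0 < r)%R by rewrite powR_gt0.
have r1 : (r < 1)%R.
  rewrite lt_neqAle -[X in _ && (_ <= X)%R](powRr0 2) ler_powR ?ler1n//; last lra.
  by rewrite andbT /r powR_eq1 gt_eqF ?ltr1n// ltNge ler0n/= lt_eqF// subr_lt0.
pose B : R := (2 * C `^ q)%R.
have B0 : (0 <= B)%R by rewrite mulr_ge0// powR_ge0.
exists (c0^-1 `^ q + B / (1 - r))%R.
  by rewrite addr_ge0 ?powR_ge0// divr_ge0// subr_ge0 ltW.
move=> x Ex.
pose sub y := E `&` [set z | phi x z <= phi x y].
have msub y : measurable (sub y).
  by apply: emeasurable_fun_infty_c => //; exact: measurable_funTS.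
pose V y := \int[sigma]_(z in sub y) (G x z * (w z `^ q)%:E).
have leV y y' : phi x y <= phi x y' -> V y <= V y'.
  move=> yy'; apply: ge0_subset_integral => //; first exact: measurable_funTS.
  by move=> z [Ez /= zy]; split => //=; rewrite (le_trans zy).
have Vw y : E y -> V y <= (C * m x / m y * w y)%:E.
  move=> Ey; apply: le_trans (sublevel_potential_le _ _ mE (mfq _ mw) _) _.
    by move=> z; rewrite lee_fin powR_ge0.
  rewrite (EFinM (C * m x / m y)%R) lee_wpmul2l ?super// lee_fin.
  by rewrite divr_ge0 ?mulr_ge0// ltW.
pose L (s : R) := E `&` [set y | V y <= s%:E].
have mL s : measurable (L s).
  apply: measurableI => //; apply: (@measurable_down_set _ _ _ _ (phi x)) => //.
  by move=> y y' /= Vy' /leV /le_trans; apply.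
have hL s : (0 <= s)%R -> \int[sigma]_(z in L s) (G x z * (w z `^ q)%:E) <= s%:E.
  move=> s0; apply: (@integral_le_sublevels _ _ _ _ _ _ (phi x)) => //.
  move=> y [Ey Vy]; apply: le_trans Vy; apply: ge0_subset_integral => //.
  - by apply: emeasurable_fun_infty_c => //; exact: measurable_funTS.
  - exact: measurable_funTS.
  - by move=> z [[Ez _] zy].
have compare (D : set T) (t s : R) : measurable D -> (0 <= t)%R -> (0 <= s)%R ->
    D `<=` L s -> (forall y, D y -> m y <= t * w y)%R ->
    \int[sigma]_(z in D) (G x z * (m z `^ q)%:E) <= (t `^ q * s)%:E.
  move=> mD t0 s0 DL Dm.
  apply: (@le_trans _ _ (\int[sigma]_(z in D)
      ((t `^ q)%:E * (G x z * (w z `^ q)%:E)))).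
    apply: ge0_le_integral_nonmeas => z Dz; first exact: Gm0.
    rewrite muleCA lee_wpmul2l// -EFinM lee_fin -powRM//; last exact: ltW.
    apply: ge0_ler_powR; rewrite ?nnegrE ?mulr_ge0//; [lra|..|exact: Dm];
      exact: ltW.
  rewrite ge0_integralZl_EFin ?powR_ge0//; last exact: measurable_funTS.
  rewrite EFinM lee_wpmul2l ?lee_fin ?powR_ge0//.
  apply: le_trans (hL s s0); apply: ge0_subset_integral => //.
  exact: measurable_funTS.
have levels k : \int[sigma]_(z in L (2 ^+ k * m x)%R) (G x z * (m z `^ q)%:E) <=
    ((c0^-1 `^ q + B * ((1 - r ^+ k) / (1 - r))) * m x)%:E.
  elim: k => [|k IH].
    (* On the lowest level V may be arbitrarily small; w >= c0 m is used. *)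
    rewrite expr0 mul1r expr0 subrr mul0r mulr0 addr0.
    apply: compare => //; [by rewrite invr_ge0 ltW|exact: ltW|].
    by move=> y [Ey _]; rewrite ler_pdivlMl// mw_le.
  pose D := L (2 ^+ k.+1 * m x)%R `\` L (2 ^+ k * m x)%R.
  have mD : measurable D by exact: measurableD.
  have -> : L (2 ^+ k.+1 * m x)%R = L (2 ^+ k * m x)%R `|` D.
    rewrite /D setDE setUIr setUv setIT; apply/esym/setUidPr => y [Ey /= Vy].
    split => //=; apply: le_trans Vy _; rewrite lee_fin ler_pM2r//.
    by rewrite exprS ler_peMl ?exprn_ge0// ler1n.
  rewrite ge0_integral_setU//; last 2 first.
  - exact: measurable_funTS.
  - by apply/disj_setPS => y [Ly [_ nLy]].
  have DB : \int[sigma]_(z in D) (G x z * (m z `^ q)%:E) <=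
      ((C / 2 ^+ k) `^ q * (2 ^+ k.+1 * m x))%:E.
    apply: compare => //.
    - by rewrite divr_ge0 ?exprn_ge0// ltW.
    - by rewrite mulr_ge0 ?exprn_ge0// ltW.
    - by move=> y [].
    move=> y [[Ey _] nL].
    have : (2 ^+ k * m x)%:E < V y by rewrite ltNge; apply/negP => Vy; apply: nL.
    move=> /lt_le_trans/(_ (Vw y Ey)); rewrite lte_fin => /ltW.
    rewrite (_ : C * m x / m y * w y = (C * w y / m y) * m x)%R; last by ring.
    rewrite ler_pM2r// ler_pdivlMr// => h.
    by rewrite mulrAC ler_pdivlMr ?exprn_gt0// mulrC.
  rewrite level_gap -/r -/B in DB.
  apply: le_trans (leeD IH DB) _; rewrite -EFinD lee_fin -mulrDl ler_pM2r//.
  rewrite -addrA lerD2l exprS le_eqVlt; apply/orP/or_introl/eqP.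
  by field; lra.
have [k kx] : exists k, (w x <= 2 ^+ k * m x)%R.
  pose n := (Num.truncn (w x / m x)).+1; exists n.
  rewrite -ler_pdivrMr// (le_trans (ltW (truncnS_gt _)))// -natrX ler_nat.
  by rewrite ltnW// ltn_expl.
rewrite (ge0_negligible_integral (measurableC mE))// setDE setCK setTI.
have EL : E = L (2 ^+ k * m x)%R.
  apply/seteqP; split=> [y Ey|y []//]; split => //=.
  apply: (@le_trans _ _ (w x)%:E); last by rewrite lee_fin.
  apply: le_trans (super x Ex); apply: ge0_subset_integral => //.
rewrite EL; apply: le_trans (levels k) _; rewrite lee_fin ler_pM2r//.
rewrite lerD2l ler_wpM2l// ler_pdivrMr ?subr_gt0// mulVf ?gt_eqF ?subr_gt0//.
by rewrite lerBlDr lerDl exprn_ge0// ltW.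
Qed.

End ptolemaic_potentials.

(** Where [w] and [m] are both at least 1/(n+1) the kernel G(x,.) is bounded
    below by a multiple of m(x), because G(x,y) dominates a multiple of min(m(x), m(y)). One
    of these sets has positive measure, and integrating over it bounds the
    potential, hence [w], from below. *)
Lemma supersolution_ge_weight d (T : measurableType d) (R : realType)
    (sigma : {measure set T -> \bar R}) (G : T -> T -> \bar R)
    (m w : T -> R) (q b k : R) (E : set T) :
  0 <= q -> 0 < b -> 0 < k ->
  (forall x y, 0 <= G x y)%E ->
  (forall x, measurable_fun setT (G x)) -> measurable_fun setT m ->
  (forall x, 0 < m x) -> (forall x, m x <= b) ->
  (forall x y, Order.min (m x)%:E (m y)%:E <= k%:E * G x y)%E ->
  measurable E -> sigma E != 0%E ->
  measurable_fun setT w -> (forall x, 0 < w x) ->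
  (forall x, E x -> \int[sigma]_z (G x z * (w z `^ q)%:E) <= (w x)%:E)%E ->
  exists2 c : R, 0 < c & forall x, E x -> c * m x <= w x.
Proof.
move=> q0 b0 k0 G0 mG mm m0 mb mG_le mE sE mw w0 super.
pose F n := E `&` [set y | n.+1%:R^-1 <= Num.min (w y) (m y)].
have mF n : measurable (F n).
  apply: measurableI => //; rewrite -[X in measurable X]setTI.
  have mmin : measurable_fun setT (fun y => Num.min (w y) (m y)) by exact: measurable_minr.
  have := mmin measurableT `[n.+1%:R^-1, +oo[%classic (measurable_itv _).
  by congr measurable; apply/seteqP; split=> y /=; rewrite in_itv/= andbT.
have [n Fn] : exists n, sigma (F n) != 0%E.
  apply: contrapT => /forallNP nF; move/negP: sE; apply.
  have -> : E = \bigcup_n F n.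
    apply/seteqP; split=> [y Ey|y [n _ []]//].
    have /ltr_add_invr[n] : 0 < Num.min (w y) (m y) by rewrite lt_min w0 m0.
    by rewrite add0r => /ltW ?; exists n.
  apply/eqP/measure_negligible; first exact: bigcupT_measurable.
  apply: negligible_bigcup => n; apply/negligibleP => //.
  exact/eqP/negPn/negP/nF.
set e := n.+1%:R^-1 : R; have e0 : 0 < e by rewrite invr_gt0.
(* The set may have infinite measure, so a finite lower bound is chosen. *)
have [s s0 sF] : exists2 s : R, 0 < s & (s%:E <= sigma (F n))%E.
  have sF0 : (0 < sigma (F n))%E by rewrite lt0e Fn/=.
  case: (sigma (F n)) sF0 => [r|_|//]; last by exists 1 => //; rewrite leey.
  by rewrite lte_fin => r0; exists r.
pose de := Num.min 1 (e / b).
have de0 : 0 < de by rewrite lt_min ltr01 divr_gt0.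
exists (k^-1 * de * e `^ q * s).
  by rewrite !mulr_gt0 ?invr_gt0 ?powR_gt0.
move=> x Ex; rewrite -lee_fin; apply: le_trans (super x Ex).
have mGw : measurable_fun setT (fun z => G x z * (w z `^ q)%:E)%E.
  apply: emeasurable_funM => //; apply/measurable_EFinP.
  exact: (measurableT_comp (measurable_powR q)).
have Gw0 z : (0 <= G x z * (w z `^ q)%:E)%E by rewrite mule_ge0// lee_fin powR_ge0.
apply: (@le_trans _ _ (\int[sigma]_(z in F n) (G x z * (w z `^ q)%:E))%E); last first.
  by apply: ge0_subset_integral => //; exact: mF.
apply: (@le_trans _ _ (\int[sigma]_(z in F n) cst (k^-1 * de * m x * e `^ q)%:E z)%E).
  rewrite integral_cst//.
  apply: (@le_trans _ _ ((k^-1 * de * m x * e `^ q)%:E * s%:E)%E); last first.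
    by rewrite lee_wpmul2l// lee_fin !mulr_ge0 ?powR_ge0 ?invr_ge0// ltW.
  by rewrite -EFinM lee_fin le_eqVlt; apply/orP/or_introl/eqP; ring.
apply: ge0_le_integral_nonmeas => z [Ez /=].
  by rewrite lee_fin !mulr_ge0 ?powR_ge0 ?invr_ge0// ltW.
rewrite -/e le_min => /andP[ew em].
rewrite EFinM lee_pmul ?lee_fin ?powR_ge0//.
- by rewrite !mulr_ge0 ?invr_ge0// ltW.
- have : ((de * m x)%:E <= Order.min (m x)%:E (m z)%:E)%E.
    rewrite le_min !lee_fin; apply/andP; split.
      by rewrite ler_piMl ?ge_min ?lexx// ltW.
    apply: le_trans em; apply: (@le_trans _ _ (e / b * b)).
      by rewrite ler_pM ?ge_min ?lexx ?orbT// ltW.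
    by rewrite divfK// gt_eqF.
  move=> /le_trans/(_ (mG_le x z)).
  by rewrite muleC -lee_pdivrMr// -EFinM mulrC mulrA.
- by apply: ge0_ler_powR; rewrite ?nnegrE// ltW.
Qed.

(** * The integral inequality for symmetric quasi-metric kernels *)

Lemma lower_semicontinuous_borel (R : realType) (M : ptopologicalType)
    (f : M -> \bar R) :
  lower_semicontinuous f -> measurable_fun setT (f : borel M -> \bar R).
Proof.
move=> lf; apply: (measurability _ (ErealGenOInfty.measurableE R)).
move=> /= _ [_ [a ->]] <-; rewrite setTI; apply: sub_sigma_algebra.
by rewrite preimage_itvoy; move/lower_semicontinuousP : lf; exact.
Qed.

Lemma ae_full_set d (T : measurableType d) (R : realType)
    (mu : {measure set T -> \bar R}) (P : T -> Prop) :
  {ae mu, forall x, P x} ->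
  exists E, [/\ measurable E, mu (~` E) = 0%E & forall x, E x -> P x].
Proof.
move=> [N [mN N0 sub]]; exists (~` N); split.
- exact: measurableC.
- by rewrite setCK.
- by move=> x Nx; apply: contrapT => nP; exact/Nx/sub.
Qed.

Lemma full_set_ae d (T : measurableType d) (R : realType)
    (mu : {measure set T -> \bar R}) (P : T -> Prop) E :
  measurable E -> mu (~` E) = 0%E -> (forall x, E x -> P x) ->
  {ae mu, forall x, P x}.
Proof.
move=> mE E0 EP; exists (~` E); split => //; first exact: measurableC.
by move=> x /= nP Ex; exact/nP/EP.
Qed.

Section quasi_metric_kernel.
Context (R : realType) (M : ptopologicalType).
Variables (sigma : {measure set (borel M) -> \bar R}) (G : M -> M -> \bar R).
Variables (q a : R) (o : M).
Hypotheses (q1 : 1 < q) (a0 : 0 < a).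
Hypotheses (G0 : forall x y, (0 < G x y)%E) (Gsym : forall x y, G x y = G y x).
Hypothesis Glsc : forall y, lower_semicontinuous (G^~ y).
Hypothesis Gquasi : quasi_metric G.

Let m (x : M) : \bar R := Order.min (G x o) (a^-1)%:E.
Let mr (x : M) : R := fine (m x).

Let G00 x y : (0 <= G x y)%E. Proof. exact/ltW/G0. Qed.

Let mrE x : (mr x)%:E = m x.
Proof.
rewrite /mr fineK// ge0_fin_numE; first by rewrite gt_min ltry orbT.
by rewrite le_min G00 lee_fin invr_ge0 ltW.
Qed.

Let mr0 x : 0 < mr x.
Proof. by rewrite -lte_fin mrE lt_min G0 lte_fin invr_gt0. Qed.

Let mr_le x : mr x <= a^-1.
Proof. by rewrite -lee_fin mrE ge_min lexx orbT. Qed.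

Let mG x : measurable_fun setT (G x : borel M -> \bar R).
Proof.
by apply: lower_semicontinuous_borel; rewrite (_ : G x = G^~ x)//; apply/funext.
Qed.

Let mmr : measurable_fun setT (mr : borel M -> R).
Proof.
apply/measurable_EFinP; rewrite (_ : _ \o _ = m); last exact/funext/mrE.
apply: measurable_mine => //.
by have := @mG o; rewrite (_ : G o = G^~ o)//; apply/funext.
Qed.

Let mq y : (m y `^ q = (mr y `^ q)%:E)%E.
Proof. by rewrite -mrE poweR_EFin. Qed.

Let int_mq x : (\int[sigma]_y (G x y * m y `^ q) =
  \int[sigma]_y (G x y * (mr y `^ q)%:E))%E.
Proof. by under eq_integral do rewrite mq. Qed.

Let mmrq : measurable_fun setT (fun y : borel M => (mr y `^ q)%:E).
Proof.
by apply/measurable_EFinP; exact: (measurableT_comp (measurable_powR q)).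
Qed.

Let q0 : 0 <= q. Proof. by rewrite ltW// (lt_trans _ q1). Qed.

(** From a solution to the bound on the potential of m^q. If sigma vanishes
    there is nothing to prove; otherwise the solution dominates a multiple of
    [m] and the level comparison applies. *)
Lemma weight_potential_of_supersolution :
  (exists u : M -> \bar R,
      (exists2 v : M -> \bar R, lower_semicontinuous v &
         {ae sigma, forall x, u x = v x}) /\
      {ae sigma, forall x, (0 < u x < +oo)%E /\
         (\int[sigma]_y (G x y * u y `^ q) <= u x)%E}) ->
  exists2 c : R, 0 < c &
      {ae sigma, forall x,
         (c%:E * \int[sigma]_y (G x y * m y `^ q) <= m x)%E}.
Proof.
move=> [u [[v lv uv] ineq]].
have [E [mE E0 EP]] : exists E : set (borel M), [/\ measurable E, sigma (~` E) = 0%E &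
    forall x, E x -> u x = v x /\ ((0 < u x < +oo)%E /\
      (\int[sigma]_y (G x y * u y `^ q) <= u x)%E)].
  have [E1 [mE1 E10 E1P]] := ae_full_set uv.
  have [E2 [mE2 E20 E2P]] := ae_full_set ineq.
  exists (E1 `&` E2); split; first exact: measurableI.
    by rewrite setCI measureU0//; exact: measurableC.
  by move=> x [/E1P ? /E2P].
have [kappa k1 quasi] := Gquasi.
have k0 : 0 < kappa by exact: lt_le_trans k1.
have [sE|sE] := eqVneq (sigma E) 0%E.
  exists 1 => //; apply: (@full_set_ae _ _ _ _ _ set0) => //.
  by rewrite setC0 -(setUv E) measureU0//; exact: measurableC.
(* [u] may be non-measurable, and even negative, on a null set; [w] is a
   positive measurable function that agrees with [u] on [E]. *)
pose w (y : borel M) : R := if y \in E then fine (v y) else 1.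
have wu y : E y -> (w y)%:E = u y.
  move=> Ey; rewrite /w mem_set//; have [vE [/andP[u0 uy] _]] := EP y Ey.
  by rewrite -vE fineK// ge0_fin_numE// ltW.
have w0 y : 0 < w y.
  have [Ey|nEy] := pselect (E y); last by rewrite /w memNset.
  by rewrite -lte_fin wu//; have [_ [/andP[]]] := EP y Ey.
have mw : measurable_fun setT w.
  apply: measurable_fun_ifT => //.
    by apply: (measurable_fun_bool true); rewrite setTI (_ : _ @^-1` _ = E)//;
      apply/seteqP; split=> y /=; [move/set_mem|move/mem_set].
  apply: measurableT_comp; first exact: fine_measurable.
  exact: lower_semicontinuous_borel.
have super x : E x -> (\int[sigma]_z (G x z * (w z `^ q)%:E) <= (w x)%:E)%E.
  move=> Ex; have [_ [_ ux]] := EP x Ex; rewrite wu//; apply: le_trans ux.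
  rewrite (ge0_negligible_integral (measurableC mE))//; last 2 first.
  - apply: emeasurable_funM => //; apply/measurable_EFinP.
    exact: (measurableT_comp (measurable_powR q)).
  - by move=> z _; rewrite mule_ge0// lee_fin powR_ge0.
  rewrite setDE setCK setTI integral_mkcond; apply: ge0_le_integral_nonmeas => z _.
    by apply: erestrict_ge0 => t _; rewrite mule_ge0// lee_fin powR_ge0.
  rewrite patchE; case: ifPn => [/set_mem Ez|_]; last by rewrite mule_ge0// poweR_ge0.
  by rewrite -poweR_EFin wu.
have [c0 c00 c0m] : exists2 c : R, 0 < c & forall x, E x -> c * mr x <= w x.
  apply: (@supersolution_ge_weight _ _ _ sigma G mr w q a^-1 kappa E) => //.
  - by rewrite invr_gt0.
  - by move=> x y; exact: (min_weight_le_green Gsym quasi mrE).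
have [A A0 AE] := @weight_potential_le_of_supersolution _ _ _ sigma G mr (kappa ^+ 2)
  q G00 Gsym mG mr0 mmr (exprn_gt0 2 k0) (ptolemy G00 Gsym k1 quasi mrE mr0)
  E w c0 q1 mE E0 mw w0 c00 c0m super.
exists (A + 1)^-1; first by rewrite invr_gt0 ltr_pwDr.
apply: (full_set_ae mE E0) => x Ex; rewrite int_mq.
rewrite muleC lee_pdivrMr ?ltr_pwDr// (le_trans (AE x Ex))// -mrE -EFinM lee_fin.
by rewrite mulrC ler_pM2l// lerDl.
Qed.

Lemma weight_potential_everywhere :
  (exists2 c : R, 0 < c &
      {ae sigma, forall x,
         (c%:E * \int[sigma]_y (G x y * m y `^ q) <= m x)%E}) ->
  exists2 c : R, 0 < c &
      forall x, (c%:E * \int[sigma]_y (G x y * m y `^ q) <= m x)%E.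
Proof.
move=> [c c0 /ae_full_set[E [mE E0 EP]]].
have [kappa k1 quasi] := Gquasi.
have k0 : 0 < kappa by exact: lt_le_trans k1.
have bound x : (\int[sigma]_z (G x z * (mr z `^ q)%:E) <=
    (kappa ^+ 2 * c^-1 * mr x)%:E)%E.
  apply: (@potential_maximum_principle _ _ _ sigma G mr (kappa ^+ 2)
    G00 Gsym mG mr0 mmr (exprn_gt0 2 k0) (ptolemy G00 Gsym k1 quasi mrE mr0)
    E (fun y => (mr y `^ q)%:E)) => //.
  - by move=> z; rewrite lee_fin powR_ge0.
  - by rewrite invr_ge0 ltW.
  move=> y Ey; have := EP y Ey; rewrite int_mq.
  by rewrite muleC -lee_pdivlMr// -mrE -EFinM mulrC.
exists (kappa ^+ 2 * c^-1)^-1; first by rewrite invr_gt0 mulr_gt0 ?invr_gt0 ?exprn_gt0.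
move=> x; rewrite int_mq.
rewrite muleC lee_pdivrMr ?mulr_gt0 ?invr_gt0 ?exprn_gt0//.
by rewrite (le_trans (bound x))// -mrE -EFinM mulrC.
Qed.

Lemma supersolution_of_weight_potential :
  (exists2 c : R, 0 < c &
      forall x, (c%:E * \int[sigma]_y (G x y * m y `^ q) <= m x)%E) ->
  exists u : M -> R,
      [/\ forall x, 0 < u x,
          lower_semicontinuous (EFin \o u) &
          forall x, (\int[sigma]_y (G x y * (u y)%:E `^ q) <= (u x)%:E)%E].
Proof.
move=> [c c0 bound].
(* The multiple l m is a solution as soon as l^q = l c. *)
pose l := c `^ (q - 1)^-1.
have l0 : 0 < l by rewrite powR_gt0.
have lq : l `^ q = l * c.
  rewrite -mulr_powRB1 ?ltW// 1?(lt_trans _ q1)//; congr (_ * _).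
  by rewrite /l -powRrM mulVf ?powRr1 ?ltW// gt_eqF// subr_gt0.
exists (fun x => l * mr x); split.
- by move=> x; rewrite mulr_gt0.
- move=> x t /=; rewrite lte_fin mulrC -ltr_pdivrMr// -lte_fin mrE lt_min.
  move=> /andP[/Glsc[V xV Vt] tb]; exists V => // y Vy.
  by rewrite lte_fin mulrC -ltr_pdivrMr// -lte_fin mrE lt_min Vt.
move=> x.
under eq_integral => y _.
  rewrite poweR_EFin powRM ?ltW// lq EFinM muleCA; over.
rewrite ge0_integralZl_EFin//; last 3 first.
- by move=> z _; rewrite mule_ge0// lee_fin powR_ge0.
- exact: emeasurable_funM.
- by rewrite mulr_ge0// ltW.
rewrite EFinM -muleA EFinM lee_pmul2l//.
by have := bound x; rewrite int_mq -mrE.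
Qed.

End quasi_metric_kernel.

(** * Determinants and integrals over cubes *)

Section determinants.
Context (R : realType).

Lemma cvg_det (T : Type) (F : set_system T) (n : nat) (A : T -> 'M[R]_n)
    (B : 'M[R]_n) : Filter F ->
  (forall i j, A t i j @[t --> F] --> B i j) ->
  \det (A t) @[t --> F] --> \det B.
Proof.
move=> FF AB; apply: cvg_big => //; first exact: add_continuous.
move=> s _; apply: cvgM; first exact: cvg_cst.
by apply: cvg_big => //; exact: mul_continuous.
Qed.

(** On the segment from the identity to [A] all matrices are positive
    definite, hence invertible, so the determinant cannot change sign; it is
    1 at the start. *)
Lemma posdef_det_gt0 (n : nat) (A : 'M[R]_n) :
  (forall w : 'rV[R]_n, w != 0 -> 0 < (w *m A *m w^T) 0 0) -> 0 < \det A.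
Proof.
move=> Apos; pose S (t : R) : 'M[R]_n := (1 - t)%:M + t *: A.
have pos (w : 'rV[R]_n) : w != 0 -> 0 < (w *m w^T) 0 0.
  have ge0 i : 0 <= w 0 i * w^T i 0 by rewrite mxE -expr2 sqr_ge0.
  move=> w0; rewrite mxE lt0r sumr_ge0// andbT.
  apply: contra w0 => /eqP h; apply/eqP/rowP => i; rewrite mxE.
  have := psumr_eq0P (fun i _ => ge0 i) h (i := i) isT.
  by rewrite mxE -expr2 => /eqP; rewrite sqrf_eq0 => /eqP.
have nonsing t : 0 <= t -> t <= 1 -> \det (S t) != 0.
  move=> t0 t1; apply/det0P => -[w w0 h].
  have : (w *m S t *m w^T) 0 0 = 0 by rewrite h mul0mx mxE.
  rewrite /S mulmxDr mulmxDl mul_mx_scalar -scalemxAr -!scalemxAl.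
  rewrite mxE [X in X + _]mxE [X in _ + X]mxE.
  have := pos w w0; have := Apos w w0.
  move: (_ 0 0) (_ 0 0) => x y y0 x0.
  have [->|tn1] := eqVneq t 1; first by rewrite subrr mul0r add0r mul1r; lra.
  have : 0 < (1 - t) * x by rewrite mulr_gt0// subr_gt0 lt_neqAle tn1.
  have : 0 <= t * y by rewrite mulr_ge0// ltW.
  lra.
have cS : continuous (fun t => \det (S t)).
  move=> t; apply: cvg_det => i j; rewrite /S.
  under eq_fun do rewrite !mxE; rewrite !mxE.
  apply: cvgD; last by apply: cvgM; [exact: cvg_id|exact: cvg_cst].
  by apply: cvgMn; apply: cvgB; [exact: cvg_cst|exact: cvg_id].
have S0 : \det (S 0) = 1 by rewrite /S subr0 scale0r addr0 det1.
have S1 : S 1 = A by rewrite /S subrr scale1r raddf0 add0r.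
rewrite ltNge; apply/negP => d0.
have [|||t] := @IVT R (fun t => \det (S t)) 0 1 0 => //.
- exact: continuous_subspaceT.
- by rewrite S0 S1 ge_min le_max d0 ler01 orbT.
rewrite in_itv/= => /andP[t0 t1] /eqP; apply/negP; exact: nonsing.
Qed.

End determinants.

Section lebesgue_cubes.
Context (R : realType).

Lemma lebesgue_int_ge0 n (f : 'rV[R]_n -> \bar R) :
  (forall v, 0 <= f v)%E -> (0 <= lebesgue_int f)%E.
Proof.
elim: n f => [|n IH] f f0 /=; first exact: f0.
by apply: integral_ge0 => t _; apply: IH => v; exact: f0.
Qed.

Lemma le_lebesgue_int n (f h : 'rV[R]_n -> \bar R) :
  (forall v, 0 <= f v)%E -> (forall v, f v <= h v)%E ->
  (lebesgue_int f <= lebesgue_int h)%E.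
Proof.
elim: n f h => [|n IH] f h f0 fh /=; first exact: fh.
apply: ge0_le_integral_nonmeas => t _.
  by apply: lebesgue_int_ge0 => v; exact: f0.
by apply: IH => v; [exact: f0|exact: fh].
Qed.

Lemma lebesgue_int_cube n (v0 : 'rV[R]_n) (r c : R) : 0 < r -> 0 <= c ->
  lebesgue_int (fun v => (c * \1_(ball v0 r) v)%:E) = (c * (2 * r) ^+ n)%:E.
Proof.
move=> r0; elim: n v0 c => [|n IH] v0 c c0 /=.
  by rewrite expr0 indicE mem_set//; split=> // i [].
pose v1 : 'rV[R]_n := @rsubmx R 1 1 n v0.
have cubeE t (v : 'rV[R]_n) :
    \1_(ball v0 r) (row_mx (const_mx t : 'rV[R]_1) v) =
    \1_(ball (v0 0 0) r) t * \1_(ball v1 r) v :> R.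
  rewrite !indicE -natrM mulnb; congr ((nat_of_bool _)%:R).
  have e0 : v0 0 0 = v0 0 (@lshift 1 n 0) by congr (v0 _ _); apply/val_inj.
  pose u : 'rV[R]_n.+1 := row_mx (const_mx t : 'rV[R]_1) v.
  have ul : u 0 (@lshift 1 n 0) = t.
    by rewrite (row_mxEl (const_mx t : 'rV[R]_1) v) mxE.
  have ur k : u 0 (@rshift 1 n k) = v 0 k.
    by rewrite (row_mxEr (const_mx t : 'rV[R]_1) v).
  have v1E k : v1 0 k = v0 0 (@rshift 1 n k) by rewrite mxE.
  apply/idP/andP => [/set_mem[_ B]|[/set_mem B0 /set_mem[_ B1]]].
    split; apply/mem_set.
      by have := B 0 (@lshift 1 n 0); rewrite -/u ul e0.
    split=> // i j; have := B i (@rshift 1 n j).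
    by rewrite (ord1 i) -/u ur v1E.
  apply/mem_set; split=> // i j; rewrite (ord1 i) -/u.
  have [k ->|k ->] := @fintype.split_ordP 1 n j.
    by rewrite (ord1 k) ul -e0.
  by have := B1 0 k; rewrite ur v1E.
transitivity (\int[@lebesgue_measure R]_t
    ((c * (2 * r) ^+ n)%:E * (\1_(ball (v0 0 0) r) t)%:E))%E.
  apply: eq_integral => t _.
  under [X in lebesgue_int X]eq_fun do rewrite cubeE mulrA.
  by rewrite IH ?mulr_ge0// -EFinM mulrAC.
rewrite ge0_integralZl_EFin//; last 2 first.
- by apply/measurable_EFinP; apply: measurable_indic; exact: measurable_ball.
- by rewrite mulr_ge0// exprn_ge0// mulr_ge0// ltW.
rewrite integral_indic//; last exact: measurable_ball.
have ballE := lebesgue_measure_ball (v0 0 0) (ltW r0).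
rewrite setIT; apply: etrans (congr1 (fun x => _ * x)%E ballE) _.
rewrite -EFinM exprS -mulr_natl.
by congr (_%:E); ring.
Qed.

End lebesgue_cubes.

(** * Small sets of positive Riemannian measure *)

Section bounded_Rintegrals.
Context d (T : measurableType d) (R : realType).
Variable mu : {measure set T -> \bar R}.

(** Truncating [f] between [l] and [r] changes it on a null set only and makes
    it integrable. *)
Lemma Rintegral_bounds (f : T -> R) (A : set T) (l r : R) :
  measurable A -> (mu A < +oo)%E -> measurable_fun A f ->
  {ae mu, forall x, A x -> l <= f x <= r} -> l <= r ->
  l * fine (mu A) <= \int[mu]_(x in A) f x <= r * fine (mu A).
Proof.
move=> mA Afin mf bnd lr.
pose f' x := Num.max l (Num.min r (f x)).
have mf' : measurable_fun A f'.
  by apply: measurable_maxr => //; exact: measurable_minr.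
have f'bnd x : l <= f' x <= r.
  by rewrite /f' le_max lexx/= ge_max lr ge_min lexx.
have -> : \int[mu]_(x in A) f x = \int[mu]_(x in A) f' x.
  congr fine; apply: ae_eq_integral => //; [exact/measurable_EFinP..|].
  have [N [mN N0 sub]] := bnd; exists N; split => // x /= nP; apply: sub => /= h.
  apply: nP => Ax; have /andP[lf fr] := h Ax.
  by rewrite /f' min_r// max_r.
have integrable_bnd (h : T -> R) (K : R) : measurable_fun A h ->
    (forall x, `|h x| <= K) -> mu.-integrable A (EFin \o h).
  move=> mh hK; apply: measurable_bounded_integrable => //.
  exists K; split; first by rewrite num_real.
  by move=> t Kt x _; exact: le_trans (hK x) (ltW Kt).
have if' : mu.-integrable A (EFin \o f').
  apply: (integrable_bnd _ (`|l| + `|r|)) => // x.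
  have /andP[lf fr] := f'bnd x; rewrite ler_norml; apply/andP; split.
    apply: le_trans lf; rewrite lerNl (le_trans (ler_norm _))// normrN lerDl//.
  by apply: le_trans fr _; rewrite (le_trans (ler_norm _))// lerDr.
have icst k : mu.-integrable A (EFin \o cst k).
  exact: (integrable_bnd _ `|k|).
rewrite -!Rintegral_cst//; apply/andP; split; apply: le_Rintegral => //.
- exact: (icst l).
- by move=> x _; have /andP[] := f'bnd x.
- exact: (icst r).
- by move=> x _; have /andP[] := f'bnd x.
Qed.

Lemma Rintegral_mulr_indic (f : T -> R) (A : set T) :
  \int[mu]_x (f x * \1_A x) = \int[mu]_(x in A) f x.
Proof.
by rewrite [RHS]Rintegral_mkcond; apply: eq_Rintegral => x _; rewrite patch_indic.
Qed.

End bounded_Rintegrals.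

Lemma cvg_vol_density (R : realType) (n : nat) (M : ptopologicalType)
    (g : riemannian R n M) (i : chart_index g) (v : 'rV[R]_n) :
  (chart i @` dom i) v -> vol_density i u @[u --> v] --> vol_density i v.
Proof.
move=> iv; apply: (@continuous_cvg _ _ _ (nbhs v) _ (fun u => \det (metric i u))
  Num.sqrt (\det (metric i v))); first exact: sqrt_continuous.
apply: cvg_det => a b.
by have [/(_ v iv)] := @metric_smooth _ _ _ g i a b 0%N.
Qed.

Lemma vol_density_gt0 (R : realType) (n : nat) (M : ptopologicalType)
    (g : riemannian R n M) (i : chart_index g) (v : 'rV[R]_n) :
  (chart i @` dom i) v -> 0 < vol_density i v.
Proof.
move=> iv; rewrite sqrtr_gt0 posdef_det_gt0// => w w0.
exact: metric_posdef.
Qed.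

Section small_sets.
Context (R : realType) (n : nat) (M : ptopologicalType).
Variables (g : riemannian R n M) (mu : {measure set (borel M) -> \bar R}).
Hypothesis rm : riemannian_measure g mu.

Lemma open_borel (A : set M) : open A -> measurable (A : set (borel M)).
Proof. exact: sub_sigma_algebra. Qed.

Lemma open_chart_ball (i : chart_index g) (v : 'rV[R]_n) (e : R) :
  open (dom i `&` chart i @^-1` ball v e).
Proof.
rewrite openE => x [ix vx]; apply: filterI.
  by apply: open_nbhs_nbhs; split => //; exact: dom_open.
apply: (chart_continuous ix); apply: open_nbhs_nbhs; split => //.
exact: ball_open.
Qed.

(** The set is the preimage of a small cube in a chart, on which the volume
    density lies between half and twice its value at the centre. *)
Lemma small_set_of_positive_measure (x : M) (U : set M) : nbhs x U ->
  exists A : set (borel M),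
    [/\ measurable A, A `<=` U, (0 < mu A)%E & (mu A < +oo)%E].
Proof.
move=> xU; pose i := chart_at g x; pose v := chart i x.
have ix : dom i x by exact: dom_chart_at.
have iv : (chart i @` dom i) v by exists x.
have D0 := vol_density_gt0 iv; set D := vol_density i v in D0.
have near1 : \forall u \near v, (chart i @` dom i) u.
  by apply: open_nbhs_nbhs; split => //; exact: chart_open.
have near2 : \forall u \near v, U (chartV i u).
  by apply: (chartV_continuous iv); rewrite chartK.
have near3 : \forall u \near v, `|D - vol_density i u| < D / 2.
  have /cvgrPdist_lt := cvg_vol_density iv.
  by apply; rewrite divr_gt0.
have : nbhs v (fun u => (chart i @` dom i) u /\
    (U (chartV i u) /\ `|D - vol_density i u| < D / 2)).
  by apply: filterI near1 _; exact: filterI near2 near3.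
move=> /nbhs_ballP[e /= e0 ballP].
pose A := dom i `&` chart i @^-1` ball v e.
have mA : measurable (A : set (borel M)) 
  by apply: open_borel; exact: open_chart_ball.
have imA : chart i @` A = ball v e.
  apply/seteqP; split=> [_ [y [_ vy] <-]//|u vu].
  have [[y iy yu] _] := ballP u vu.
  exists y => //; split => //.
  by have : ball v e (chart i y) by rewrite yu.
have muA := rm mA (fun y => @proj1 _ _).
rewrite imA in muA.
have vol_bounds u : ball v e u -> D / 2 <= vol_density i u <= 2 * D.
  by move=> /ballP[_ [_]]; rewrite ltr_norml => /andP[? ?]; apply/andP; split; lra.
exists A; split => //.
- move=> y [iy vy]; have [_ [Uy _]] := ballP _ vy.
  by rewrite -(chartK iy).
- rewrite muA; apply: (@lt_le_trans _ _ (D / 2 * (2 * e) ^+ n)%:E).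
    by rewrite lte_fin !mulr_gt0 ?exprn_gt0 ?mulr_gt0.
  rewrite -(lebesgue_int_cube v)//; last by rewrite ltW// divr_gt0.
  apply: le_lebesgue_int => u.
    by rewrite lee_fin mulr_ge0// ltW// divr_gt0.
  rewrite lee_fin indicE; have [/set_mem/vol_bounds/andP[h _]|_] := boolP (_ \in _).
    by rewrite !mulr1.
  by rewrite !mulr0.
- rewrite muA; apply: (@le_lt_trans _ _ (2 * D * (2 * e) ^+ n)%:E); last exact: ltry.
  rewrite -(lebesgue_int_cube v)//; last by rewrite mulr_ge0// ltW.
  apply: le_lebesgue_int => u.
    by rewrite lee_fin mulr_ge0// sqrtr_ge0.
  rewrite lee_fin indicE; have [/set_mem/vol_bounds/andP[_ h]|_] := boolP (_ \in _).
    by rewrite !mulr1.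
  by rewrite !mulr0.
Qed.

Lemma indic_L2 (A : set (borel M)) : measurable A -> (mu A < +oo)%E ->
  L2 mu \1_A.
Proof.
move=> mA Afin; rewrite /L2; apply/andP; split; rewrite inE/=.
  exact: measurable_indic.
rewrite /finite_norm unlock; apply: poweR_lty.
rewrite (eq_integral (EFin \o \1_A)); last first.
  move=> x _ /=; rewrite indicE; case: (_ \in _); first by rewrite normr1 powR1.
  by rewrite normr0 powR0.
by rewrite integral_indic// setIT.
Qed.

End small_sets.

(** * Symmetry of the heat kernel *)

Section heat_kernel_symmetry.
Context (R : realType) (n : nat) (M : ptopologicalType).
Variables (g : riemannian R n M) (mu : {measure set (borel M) -> \bar R}).
Variable p : R -> M -> M -> R.

(** Joint continuity of the heat kernel, written in the coordinates chosen at
    the two points. *)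
Lemma heat_kernel_near t x y e : kernel_smooth g p -> 0 < t -> 0 < e ->
  exists2 r : R, 0 < r & forall s x' y',
    `|t - s| < r -> dom (chart_at g x) x' -> dom (chart_at g y) y' ->
    ball (chart (chart_at g x) x) r (chart (chart_at g x) x') ->
    ball (chart (chart_at g y) y) r (chart (chart_at g y) y') ->
    `|p t x y - p s x' y'| < e.
Proof.
move=> sp t0 e0; set i := chart_at g x; set j := chart_at g y.
have ix : dom i x by exact: dom_chart_at.
have jy : dom j y by exact: dom_chart_at.
pose W s x' y' : 'rV[R]_(1 + (n + n)) :=
  row_mx (const_mx s) (row_mx (chart i x') (chart j y')).
have Wl s x' y' : lsubmx (W s x' y') 0 0 = s by rewrite row_mxKl mxE.
have Wx s x' y' : lsubmx (rsubmx (W s x' y')) = chart i x'.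
  by rewrite row_mxKr row_mxKl.
have Wy s x' y' : rsubmx (rsubmx (W s x' y')) = chart j y'.
  by rewrite row_mxKr row_mxKr.
have [/(_ (W t x y)) cF _] := sp i j 0%N.
have {}cF := cF _; rewrite /= Wl Wx Wy in cF.
have {}cF := cF (And3 t0 (imageP _ ix) (imageP _ jy)).
have := cF _ (nbhsx_ballx _ _ e0).
rewrite /= Wl Wx Wy !chartK// => /nbhs_ballP[r /= r0 rP].
exists r => // s x' y' ts ix' jy' xx' yy'.
have := rP (W s x' y'); rewrite /= Wl Wx Wy !chartK//; apply.
split=> // k l; rewrite (ord1 k).
have [h ->|h ->] := fintype.split_ordP l.
  by rewrite /W !row_mxEl !mxE.
rewrite /W !row_mxEr.
have [h' ->|h' ->] := fintype.split_ordP h; rewrite ?row_mxEl ?row_mxEr.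
  by have [_] := xx'; exact.
by have [_] := yy'; exact.
Qed.

Lemma heat_kernel_near_sets t x y e : kernel_smooth g p -> 0 < t -> 0 < e ->
  exists U V, [/\ nbhs x U, nbhs y V &
    forall x' y', U x' -> V y' -> `|p t x y - p t x' y'| < e].
Proof.
move=> sp t0 e0; have [r r0 rP] := heat_kernel_near x y sp t0 e0.
pose U z := dom (chart_at g z) `&` chart (chart_at g z) @^-1` ball (chart (chart_at g z) z) r.
have nU z : nbhs z (U z).
  apply: open_nbhs_nbhs; split; first exact: open_chart_ball.
  by split; [exact: dom_chart_at|exact: ballxx].
exists (U x), (U y); split => // x' y' [ix xx'] [jy yy'].
by apply: rP => //; rewrite subrr normr0.
Qed.

(** If p(t,x,y) > p(t,y,x), then by continuity there are small sets X near x
    and Y near y of positive finite measure such that p(t,.,.) is at least c2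
    on X * Y and at most c1 < c2 on Y * X. Testing the self-adjointness of
    e^(t Delta) on the two indicator functions gives c2 <= c1. *)
Lemma heat_kernel_le_sym t x y : riemannian_measure g mu ->
  heat_kernel g mu p -> 0 < t -> p t x y <= p t y x.
Proof.
move=> rm [sp p0 [A [P [_ [/(_ t) Psa _ _ _ _] Pp]]]] t0.
have [PL2 _ _ Psym] := Psa (ltW t0).
rewrite leNgt; apply/negP => lt_p.
(* A third of the gap, so that the two bounds c1 and c2 stay apart. *)
pose e := (p t x y - p t y x) / 3.
have e0 : 0 < e by rewrite divr_gt0// subr_gt0.
have [U1 [V1 [xU1 yV1 near1]]] := heat_kernel_near_sets x y sp t0 e0.
have [V2 [U2 [yV2 xU2 near2]]] := heat_kernel_near_sets y x sp t0 e0.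
have [X [mX XU X0 Xy]] := small_set_of_positive_measure rm (filterI xU1 xU2).
have [Y [mY YV Y0 Yy]] := small_set_of_positive_measure rm (filterI yV1 yV2).
pose c1 := p t y x + e; pose c2 := p t x y - e; pose K := p t x y + e.
have pXY x' y' : X x' -> Y y' -> c2 <= p t x' y' <= K.
  move=> /XU[ux _] /YV[vy _]; have := near1 x' y' ux vy.
  by rewrite ltr_norml /c2 /K => /andP[? ?]; apply/andP; split; lra.
have pYX y' x' : Y y' -> X x' -> 0 <= p t y' x' <= c1.
  move=> /YV[_ vy] /XU[_ ux]; have := near2 y' x' vy ux.
  by rewrite ltr_norml /c1 => /andP[? ?]; rewrite ltW ?p0//=; lra.
have apply_bounds (B : set (borel M)) (D : set (borel M)) l r : measurable B ->
    (mu B < +oo)%E -> l <= r ->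
    (forall z z', D z -> B z' -> l <= p t z z' <= r) ->
    {ae mu, forall z, D z -> l * fine (mu B) <= P t \1_B z <= r * fine (mu B)}.
  move=> mB By lr bnd.
  have [N [mN N0 sub]] := Pp t \1_B t0 (indic_L2 mB By).
  exists N; split => // z /= nP; apply: sub => /= -[intz Pz]; apply: nP => Dz.
  rewrite Pz Rintegral_mulr_indic; apply: Rintegral_bounds => //.
    move/integrableP: intz => [/measurable_EFinP mz _].
    have : measurable_fun B (fun y : borel M => p t z y * \1_B y) by exact: measurable_funTS.
    apply: eq_measurable_fun => z' /= yB.
    by rewrite indicE yB mulr1.
  by apply: aeW => z' Bz'; exact: bnd.
have L2X := indic_L2 mX Xy; have L2Y := indic_L2 mY Yy.
have mP B : L2 mu B -> measurable_fun setT (P t B : borel M -> R).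
  by move=> /PL2/andP[]; rewrite inE.
have fX : 0 < fine (mu X) by rewrite fine_gt0// X0.
have fY : 0 < fine (mu Y) by rewrite fine_gt0// Y0.
have lo : c2 * fine (mu Y) * fine (mu X) <= L2_inner mu (P t \1_Y) \1_X.
  rewrite /L2_inner Rintegral_mulr_indic.
  have c2K : c2 <= K by rewrite /c2 /K; lra.
  have bnd := apply_bounds Y X c2 K mY Yy c2K pXY.
  have mPY : measurable_fun X (P t \1_Y) by apply: measurable_funTS; exact: mP.
  by have /andP[] := Rintegral_bounds mX Xy mPY bnd (ler_wpM2r (ltW fY) c2K).
have hi : L2_inner mu \1_Y (P t \1_X) <= c1 * fine (mu X) * fine (mu Y).
  rewrite /L2_inner; under eq_Rintegral do rewrite mulrC.
  rewrite Rintegral_mulr_indic.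
  have c10 : 0 <= c1 by rewrite /c1 addr_ge0 ?ltW// p0.
  have bnd := apply_bounds X Y 0 c1 mX Xy c10 pYX.
  have mPX : measurable_fun Y (P t \1_X) by apply: measurable_funTS; exact: mP.
  by have /andP[] := Rintegral_bounds mY Yy mPX bnd (ler_wpM2r (ltW fX) c10).
have := le_trans lo (le_trans _ hi); rewrite Psym// lexx => /(_ isT).
rewrite mulrAC ler_pM2r// ler_pM2r// /c1 /c2 /e.
lra.
Qed.

Lemma heat_kernel_sym t x y : riemannian_measure g mu ->
  heat_kernel g mu p -> 0 < t -> p t x y = p t y x.
Proof. by move=> *; apply/eqP; rewrite eq_le !heat_kernel_le_sym. Qed.

End heat_kernel_symmetry.

(** * The Green kernel *)

Section green_kernel.
Context (R : realType) (n : nat) (M : ptopologicalType).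
Variables (g : riemannian R n M) (mu : {measure set (borel M) -> \bar R}).
Variables (p : R -> M -> M -> R) (alpha : R).
Hypotheses (rm : riemannian_measure g mu) (hp : heat_kernel g mu p).

Local Notation D := (`]0, +oo[%classic : set R).
Let integrand x y (s : R) : \bar R := (s `^ (alpha - 1) * p s x y)%:E.

Let D_gt0 (s : R) : D s -> 0 < s. Proof. by rewrite /= in_itv/= andbT. Qed.

Let p_gt0 t x y : 0 < t -> 0 < p t x y.
Proof. by case: hp => _ + _; exact. Qed.

Lemma heat_kernel_time_continuous x y s : 0 < s ->
  {for s, continuous (fun t => p t x y)}.
Proof.
move=> s0; apply/cvgrPdist_lt => e e0; have [sp _ _] := hp.
have [r r0 rP] := heat_kernel_near x y sp s0 e0.
apply/nbhs_ballP; exists r => // t st.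
by apply: rP => //; rewrite ?chartK; [exact: dom_chart_at..|exact: ballxx|exact: ballxx].
Qed.

Let integrand_gt0 x y s : D s -> (0 < integrand x y s)%E.
Proof. by move=> /D_gt0 s0; rewrite lte_fin mulr_gt0 ?powR_gt0 ?p_gt0. Qed.

Let measurable_integrand x y : measurable_fun D (integrand x y).
Proof.
apply/measurable_EFinP; apply: measurable_funM.
  by apply: measurable_funTS; exact: measurable_powR.
apply: open_continuous_measurable_fun; first exact: interval_open.
by move=> s /set_mem/D_gt0; exact: heat_kernel_time_continuous.
Qed.

Lemma green_sym x y : green p alpha x y = green p alpha y x.
Proof.
rewrite /green; congr (_ * _)%E; apply: eq_integral => s /set_mem/D_gt0 s0.
by rewrite (heat_kernel_sym x y rm hp s0).
Qed.

Lemma gamma_fun_ge0 : 0 <= gamma_fun alpha.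
Proof.
by apply: Rintegral_ge0 => s _; rewrite mulr_ge0 ?powR_ge0 ?expR_ge0.
Qed.

Hypothesis gamma0 : gamma_fun alpha != 0.

Let gamma_gt0 : 0 < gamma_fun alpha.
Proof. by rewrite lt_neqAle eq_sym gamma0 gamma_fun_ge0. Qed.

Lemma green_gt0 x y : (0 < green p alpha x y)%E.
Proof.
rewrite /green mule_gt0 ?lte_fin ?invr_gt0//.
have ge0 s : D s -> (0 <= integrand x y s)%E by move=> /integrand_gt0/ltW.
rewrite lt0e integral_ge0 ?andbT//; apply/eqP => I0.
have mD : measurable D by exact: measurable_itv.
have [ae0 _] := ae_eq_integral_abs (@lebesgue_measure R) mD (measurable_integrand x y).
have [|N [mN N0 sub]] := ae0.
  rewrite -[RHS]I0; apply: eq_integral => s /set_mem Ds.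
  by rewrite gee0_abs// ge0.
have : (lebesgue_measure D <= lebesgue_measure N)%E.
  apply: le_measure; rewrite ?inE//; apply: subset_trans sub => s Ds /= h.
  by have := integrand_gt0 x y Ds; rewrite h// ltxx.
by rewrite N0 lebesgue_measure_itv/= ltry.
Qed.

(** If G(.,y) <= a at points arbitrarily close to x, choose such points in
    chart balls shrinking to x; the integrands converge for each time by
    continuity of the heat kernel, and Fatou's lemma yields G(x,y) <= a. *)
Lemma green_lower_semicontinuous y : lower_semicontinuous (green p alpha ^~ y).
Proof.
move=> x a aG; apply: contrapT => nV.
have [sp _ _] := hp; set i := chart_at g x.
pose V k := dom i `&` chart i @^-1` ball (chart i x) k.+1%:R^-1.
have nbhsV k : nbhs x (V k).
  apply: open_nbhs_nbhs; split; first exact: open_chart_ball.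
  by split; [exact: dom_chart_at|exact: ballxx].
have /choice[z zP] : forall k, exists z, V k z /\ (green p alpha z y <= a%:E)%E.
  move=> k; apply: contrapT => nz; apply: nV; exists (V k) => // z Vz.
  by rewrite ltNge; apply/negP => zy; apply: nz; exists z.
have cvgp s : D s -> integrand (z k) y s @[k --> \oo] --> integrand x y s.
  move=> /D_gt0 s0; apply: cvg_EFin; first by apply: nearW.
  apply: cvgM; first exact: cvg_cst.
  apply/cvgrPdist_lt => e e0.
  have [r r0 rP] := heat_kernel_near x y sp s0 e0.
  near=> k; have [[ik zk] _] := zP k.
  apply: rP => //; first by rewrite subrr normr0.
  - exact: dom_chart_at.
  - apply: le_ball zk; near: k.
    have [K _ KP] := near_infty_natSinv_lt (PosNum r0).
    by exists K => // k /KP/ltW.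
  - exact: ballxx.
have mD : measurable D by exact: measurable_itv.
have := @fatou _ _ _ (@lebesgue_measure R) D mD (fun k => integrand (z k) y)
  (fun k => measurable_integrand (z k) y) (fun k s Ds => ltW (integrand_gt0 (z k) y Ds)).
have -> : (\int[lebesgue_measure]_(s in D) limn_einf (fun k => integrand (z k) y s) =
    \int[lebesgue_measure]_(s in D) integrand x y s)%E.
  apply: eq_integral => s /set_mem/cvgp cvgs.
  by rewrite is_cvg_limn_einfE; [exact/cvg_lim|apply/cvg_ex; eexists; exact: cvgs].
have Iz k : (\int[lebesgue_measure]_(s in D) integrand (z k) y s <=
    (a * gamma_fun alpha)%:E)%E.
  have [_] := zP k; rewrite /green muleC lee_pdivrMr//.
apply/negP; rewrite -ltNge limn_einf_lim.
apply: (@le_lt_trans _ _ (a * gamma_fun alpha)%:E).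
  apply: lime_le; first exact: is_cvg_einfs.
  apply: nearW => k; apply: le_trans (Iz k).
  by apply: ereal_inf_lbound; exists k => /=.
by move: aG; rewrite /green muleC lte_pdivlMr.
Unshelve. all: by end_near. Qed.

End green_kernel.

(** * The equivalence for the fractional Laplacian *)

Theorem theorem1p8 (R : realType) (n : nat) (M : ptopologicalType)
    (g : riemannian R n M)
    (mu : {measure set (borel M) -> \bar R})
    (p : R -> M -> M -> R)
    (alpha q : R)
    (sigma : {measure set (borel M) -> \bar R})
    (o : M) (a : R) :
  connected [set: M] -> ~ compact [set: M] -> complete_riemannian g ->
  riemannian_measure g mu -> heat_kernel g mu p ->
  0 < alpha -> alpha < 1 -> 1 < q ->
  radon sigma ->
  transient mu (green p alpha) ->
  quasi_metric (green p alpha) ->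
  0 < a ->
  let G := green p alpha in
  let m := fun x : M => Order.min (G x o) (a^-1)%:E in
  [<->
    exists u : M -> \bar R,
      (exists2 v : M -> \bar R, lower_semicontinuous v &
         {ae sigma, forall x, u x = v x}) /\
      {ae sigma, forall x, (0 < u x < +oo)%E /\
         (\int[sigma]_y (G x y * u y `^ q) <= u x)%E};
    exists u : M -> R,
      [/\ forall x, 0 < u x,
          lower_semicontinuous (EFin \o u) &
          forall x, (\int[sigma]_y (G x y * (u y)%:E `^ q) <= (u x)%:E)%E];
    exists2 c : R, 0 < c &
      {ae sigma, forall x,
         (c%:E * \int[sigma]_y (G x y * m y `^ q) <= m x)%E};
    exists2 c : R, 0 < c &
      forall x, (c%:E * \int[sigma]_y (G x y * m y `^ q) <= m x)%E
  ].
Proof.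
move=> _ _ _ rm hp _ _ q1 _ _ quasi a0 G m.
pose P1 := exists u : M -> \bar R,
  (exists2 v : M -> \bar R, lower_semicontinuous v &
     {ae sigma, forall x, u x = v x}) /\
  {ae sigma, forall x, (0 < u x < +oo)%E /\
     (\int[sigma]_y (G x y * u y `^ q) <= u x)%E}.
pose P2 := exists u : M -> R,
  [/\ forall x, 0 < u x, lower_semicontinuous (EFin \o u) &
      forall x, (\int[sigma]_y (G x y * (u y)%:E `^ q) <= (u x)%:E)%E].
pose P3 := exists2 c : R, 0 < c &
  {ae sigma, forall x, (c%:E * \int[sigma]_y (G x y * m y `^ q) <= m x)%E}.
pose P4 := exists2 c : R, 0 < c &
  forall x, (c%:E * \int[sigma]_y (G x y * m y `^ q) <= m x)%E.
have P21 : P2 -> P1.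
  move=> [u [u0 lu uint]]; exists (EFin \o u); split.
    by exists (EFin \o u) => //; exact: aeW.
  by apply: aeW => x; rewrite lte_fin u0 ltry; split => //; exact: uint.
(* As 0^-1 = 0, a vanishing normalising factor would make G vanish, and then
   each condition holds trivially. *)
have [gamma0|gamma0] := eqVneq (gamma_fun alpha) 0.
  have GE x y : G x y = 0%E by rewrite /G /green gamma0 invr0 mul0e.
  have int0 x (f : M -> \bar R) : (\int[sigma]_y (G x y * f y) = 0)%E.
    by apply: integral0_eq => y _; rewrite GE mul0e.
  have p2 : P2.
    exists (cst 1); split => // x; last by rewrite int0.
    by move=> t t1; exists setT => //; exact: filterT.
  have p4 : P4.
    exists 1 => // x; rewrite int0 mule0 /m GE le_min lexx lee_fin.
    by rewrite invr_ge0 ltW.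
  have p1 := P21 p2.
  by tfae => // _; have [c c0 cP] := p4; exists c => //; exact: aeW.
have G0 := green_gt0 hp gamma0.
have Gsym := green_sym alpha rm hp.
have Glsc := green_lower_semicontinuous hp gamma0.
have P13 : P1 -> P3 :=
  weight_potential_of_supersolution o q1 a0 G0 Gsym Glsc quasi.
have P34 : P3 -> P4 :=
  weight_potential_everywhere a0 G0 Gsym Glsc quasi.
have P42 : P4 -> P2 :=
  supersolution_of_weight_potential q1 a0 G0 Gsym Glsc.
tfae.
- by move=> /P13/P34/P42.
- by move=> /P21/P13.
- by move=> /P34.
- by move=> /P42/P21.
Qed.
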